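(* For a positive integer $d$, let $w(d)$ be the largest number with the property that whenever $\mathcal{G}$ is a family of $2d+1$ convex sets in $\mathbb{R}^d$ such that any $2d$ members of $\mathcal{G}$ have an intersection of volume at least $1$, then $\mathrm{vol}(\bigcap_{C\in\mathcal{G}}C)\ge w(d)$. Then for every positive integer $d$ and every $\varepsilon>0$ there exists $c_0=c_0(d,\varepsilon)>0$ such that the following holds: if $\alpha\in(0,1]$ and $\mathcal{F}$ is a family of $n$ convex sets in $\mathbb{R}^d$ such that at least $\alpha\binom{n}{2d}$ of the $2d$-element subfamilies of $\mathcal{F}$ have an intersection of volume at least $1$, then there are at least $c_0\alpha n$ members of $\mathcal{F}$ whose common intersection has volume at least $(1-\varepsilon)w(d)$.
   Context: $\mathrm{vol}$ denotes $d$-dimensional Lebesgue measure.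
   Formalization: The family is assumed to have n ≥ 2d members; for 1 ≤ n < 2d the binomial coefficient is 0, so the hypothesis is vacuous and the claim fails, e.g. for a family of empty sets. *)

(* Defs.v *)
From HB Require Import structures.
From mathcomp Require Import all_boot all_order all_algebra.
From mathcomp Require Import all_classical all_reals all_analysis.
Set Implicit Arguments. Unset Strict Implicit. Unset Printing Implicit Defensive.
Import Order.TTheory GRing.Theory Num.Theory.
Local Open Scope classical_set_scope.
Local Open Scope ring_scope.

Definition convex {R : realType} {d : nat} (C : set 'rV[R]_d) : Prop :=
  @convex_set R 'rV[R]_d C.

Definition box {R : realType} {d : nat} (a b : 'rV[R]_d) : set 'rV[R]_d :=
  [set x | forall i : 'I_d, a ord0 i <= x ord0 i <= b ord0 i].

Definition boxvol {R : realType} {d : nat} (a b : 'rV[R]_d) : R :=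
  \prod_(i < d) Num.max (b ord0 i - a ord0 i) 0.

(* d-dimensional Lebesgue (outer) measure: infimum of the total volume of
   countable covers by boxes.  On Lebesgue measurable sets (in particular on
   convex sets) this is the d-dimensional Lebesgue measure. *)
Definition vol {R : realType} {d : nat} (A : set 'rV[R]_d) : \bar R :=
  ereal_inf [set s : \bar R | exists (a b : nat -> 'rV[R]_d),
     A `<=` \bigcup_k box (a k) (b k) /\
     s = (\sum_(0 <= k <oo) (boxvol (a k) (b k))%:E)%E].

Definition wprop {R : realType} (d : nat) (w : R) : Prop :=
  forall G : 'I_(2 * d).+1 -> set 'rV[R]_d,
    (forall i, convex (G i)) ->
    (forall i : 'I_(2 * d).+1, (1%:E <= vol (\bigcap_(j in [set j | j != i]) G j))%E) ->
    (w%:E <= vol (\bigcap_j G j))%E.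

Definition wd {R : realType} (d : nat) : \bar R :=
  ereal_sup [set w%:E | w in [set w : R | wprop d w]].

(* Main.v *)
Require Import Defs.
From HB Require Import structures.
From mathcomp Require Import all_boot all_order all_algebra.
From mathcomp Require Import all_classical all_reals all_analysis.
From mathcomp Require Import perm zify lra ring.
Import Order.TTheory GRing.Theory Num.Theory.
Local Open Scope classical_set_scope.
Local Open Scope ring_scope.

(** Write H_t for the cube [-t, t]^d, where t may be infinite.  For a subfamily U
    whose intersection has volume at least 1 choose t(U) such that the part of
    this intersection in H_t(U) has volume between 1 and 2.  If 2d members T of F
    have an intersection of volume at least 1, let C in T maximize t(T - C), and
    put t := t(T - C).  Any 2d of the 2d + 1 convex sets T, H_t meet in volume at
    least 1, so the part of the intersection of T in H_t has volume at least
    w(d).  It lies in C and in the part K in H_t of the intersection of T - C,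
    which has volume at most 2 and depends only on T - C.  By pigeonhole over the
    (2d - 1)-element subfamilies, one such K has a part of volume at least w(d) in
    common with each of at least alpha n / (2d)^2 members of F.

    Finally K fits in a parallelepiped of volume O_d(1).  Cut it into M^d cells: a
    convex set is filled by the cells it contains up to a volume O_d(1/M), so that
    a second pigeonhole, over the sets of cells, finishes the proof. *)

(** * Lebesgue outer measure *)

Lemma boxvol_ge0 {R : realType} {d : nat} (a b : 'rV[R]_d) : 0 <= boxvol a b.
Proof. by apply: prodr_ge0 => i _; rewrite le_max lexx orbT. Qed.

Lemma vol_ge0 {R : realType} {d : nat} (A : set 'rV[R]_d) : (0 <= vol A)%E.
Proof.
apply: le_ereal_inf_tmp => _ [a [b [_ ->]]].
by apply: nneseries_ge0 => k _ _; rewrite lee_fin boxvol_ge0.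
Qed.

Lemma vol_cover {R : realType} {d : nat} (A : set 'rV[R]_d)
    (a b : nat -> 'rV[R]_d) :
  A `<=` \bigcup_k box (a k) (b k) ->
  (vol A <= \sum_(0 <= k <oo) (boxvol (a k) (b k))%:E)%E.
Proof. by move=> AS; apply: ereal_inf_lbound; exists a, b. Qed.

Lemma le_vol {R : realType} {d : nat} (A B : set 'rV[R]_d) :
  A `<=` B -> (vol A <= vol B)%E.
Proof.
move=> AB; apply: le_ereal_inf_tmp => _ [a [b [BS ->]]].
by apply: vol_cover; apply: subset_trans BS.
Qed.

(** A bijection between [nat] and pairs turns the doubly indexed boxes into one cover; unordered
    sums ([esum]) identify the two ways of summing. *)
Lemma vol_cover_pair {R : realType} {d : nat} (A : set 'rV[R]_d)
    (a b : nat -> nat -> 'rV[R]_d) :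
  A `<=` \bigcup_n \bigcup_k box (a n k) (b n k) ->
  (vol A <= \sum_(0 <= n <oo) \sum_(0 <= k <oo) (boxvol (a n k) (b n k))%:E)%E.
Proof.
move=> AS; have v0 n k : (0 <= (boxvol (a n k) (b n k))%:E)%E.
  by rewrite lee_fin boxvol_ge0.
have /card_esym/ppcard_eqP[f] := card_nat2.
apply: (@le_trans _ _ (\sum_(0 <= m <oo)
    (boxvol (a (f m).1 (f m).2) (b (f m).1 (f m).2))%:E)%E).
  apply: vol_cover => x /AS[n _ [k _ xnk]].
  exists (f^-1%FUN (n, k)) => //=.
  by rewrite invK ?inE.
rewrite nneseries_esumT//.
rewrite -(@reindex_esum _ _ _ setT setT f
  (fun p => (boxvol (a p.1 p.2) (b p.1 p.2))%:E)); last exact: 'bij_f.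
rewrite nneseries_esumT; last by move=> n; apply: nneseries_ge0.
under [X in (_ <= X)%E]eq_esum do rewrite nneseries_esumT//.
rewrite (@esum_esum _ _ _ setT (fun=> setT)
  (fun n k => (boxvol (a n k) (b n k))%:E))//.
by rewrite le_eqVlt; apply/orP; left; apply/eqP; congr esum; apply/seteqP.
Qed.

(** Cover [A n] up to an excess of e / 2^(n+1); the excesses add up to at most e. An infinite volume
    is treated first, because near-optimal covers are extracted from a finite infimum. *)
Lemma vol_sigma_subadditive {R : realType} {d : nat} :
  sigma_subadditive (@vol R d).
Proof.
move=> A; have [[i Aioo]|Afin] := pselect (exists i, vol (A i) = +oo%E).
  rewrite (eseries_pinfty _ _ Aioo) ?leey// => n _.
  by rewrite -ltNye (lt_le_trans _ (vol_ge0 _)).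
apply/lee_addgt0Pr => e e0.
apply: le_trans (epsilon_trick _ (fun n => vol_ge0 (A n)) (ltW e0)).
have [a Pa] : {ab : nat -> (nat -> 'rV[R]_d) * (nat -> 'rV[R]_d) &
    forall n, A n `<=` \bigcup_k box ((ab n).1 k) ((ab n).2 k) /\
    (\sum_(0 <= k <oo) (boxvol ((ab n).1 k) ((ab n).2 k))%:E
      <= vol (A n) + (e / (2 ^ n.+1)%:R)%:E)%E}.
  apply: (@choice _ _ (fun n ab => A n `<=` \bigcup_k box (ab.1 k) (ab.2 k) /\
    (\sum_(0 <= k <oo) (boxvol (ab.1 k) (ab.2 k))%:E
      <= vol (A n) + (e / (2 ^ n.+1)%:R)%:E)%E)) => n.
  have en : 0 < e / (2 ^ n.+1)%:R by rewrite divr_gt0// ltr0n expn_gt0.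
  have fn : vol (A n) \is a fin_num.
    rewrite ge0_fin_numE ?vol_ge0// ltey; apply/eqP => voo.
    by apply: Afin; exists n.
  have [_ [a [b [AS ->]]] /ltW le] := lb_ereal_inf_adherent en fn.
  by exists (a, b).
apply: (@le_trans _ _ (\sum_(0 <= n <oo) \sum_(0 <= k <oo)
    (boxvol ((a n).1 k) ((a n).2 k))%:E)%E).
  apply: vol_cover_pair => x [n _ Anx].
  by exists n => //; apply: (Pa n).1.
apply: lee_nneseries => [n _ _|n _]; last exact: (Pa n).2.
by apply: nneseries_ge0 => k _ _; rewrite lee_fin boxvol_ge0.
Qed.

(** The dimension is written [d.+1] from here on: in dimension 0 every box has volume 1, an empty
    product, and degenerate boxes do not exist. *)
Lemma vol0 {R : realType} {d : nat} : vol (set0 : set 'rV[R]_d.+1) = 0%E.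
Proof.
apply/eqP; rewrite eq_le vol_ge0 andbT.
apply: (le_trans (@vol_cover _ _ _ (fun=> 0) (fun=> 0) _)) => //.
rewrite eseries0// => k _ _.
by rewrite /boxvol big_ord_recl subrr maxxx mul0r.
Qed.

HB.instance Definition _ (R : realType) (d : nat) :=
  isOuterMeasure.Build R 'rV[R]_d.+1 (@vol R d.+1) vol0 vol_ge0 le_vol
    vol_sigma_subadditive.

Lemma vol_box_le {R : realType} {d : nat} (a b : 'rV[R]_d.+1) :
  (vol (box a b) <= (boxvol a b)%:E)%E.
Proof.
pose a' k : 'rV[R]_d.+1 := if k is 0%N then a else 0.
pose b' k : 'rV[R]_d.+1 := if k is 0%N then b else 0.
apply: (le_trans (@vol_cover _ _ _ a' b' _)); first by move=> x; exists 0%N.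
rewrite nneseries_recl//; last by move=> k _; rewrite lee_fin boxvol_ge0.
rewrite eseries0 ?adde0// => -[|k]// _ _.
by rewrite /boxvol big_ord_recl subrr maxxx mul0r.
Qed.

Lemma vol_bigsetU_le {R : realType} {d : nat} (I : Type) (r : seq I) (P : pred I)
    (F : I -> set 'rV[R]_d.+1) :
  (vol (\big[setU/set0]_(i <- r | P i) F i) <= \sum_(i <- r | P i) vol (F i))%E.
Proof.
elim/big_ind2 : _ => //; first by rewrite vol0.
by move=> A x B y Ax By; apply: le_trans (outer_measureU2 _ _ _) (leeD Ax By).
Qed.

Lemma vol_affine_le {R : realType} {d : nat} (p : 'rV[R]_d) (c : R)
    (A : set 'rV[R]_d) :
  0 < c -> (vol [set (p + c *: x)%R | x in A] <= (c ^+ d)%:E * vol A)%E.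
Proof.
move=> c0; rewrite -lee_pdivrMl ?exprn_gt0//.
apply: le_ereal_inf_tmp => _ [a [b [AS ->]]].
rewrite lee_pdivrMl ?exprn_gt0// -nneseriesZl; last first.
  by move=> k _; rewrite lee_fin boxvol_ge0.
apply: (le_trans (@vol_cover _ _ _ (fun k => p + c *: a k)
  (fun k => p + c *: b k) _)).
  move=> _ [x /AS [k _ xk] <-]; exists k => // i.
  by rewrite !mxE !lerD2l !ler_pM2l.
rewrite le_eqVlt; apply/orP; left; apply/eqP/eq_eseriesr => k _.
rewrite -EFinM; congr EFin.
have -> : c ^+ d = \prod_(i < d) c by rewrite prodr_const card_ord.
rewrite /boxvol -big_split/=.
apply: eq_bigr => i _; rewrite !mxE maxr_pMr ?ltW// mulr0; congr Num.max.
ring.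
Qed.

(** Cutting each box of a cover at height [t] in coordinate [i] gives two boxes whose volumes add up
    exactly. The inequalities on [S] allow the bounding hyperplane to be included or not, which
    serves both faces of a cube. *)
Lemma caratheodory_halfspace {R : realType} {d : nat} (i : 'I_d.+1) (t : R)
    (S : set 'rV[R]_d.+1) :
  (forall x, S x -> x ord0 i <= t) -> (forall x, ~ S x -> t <= x ord0 i) ->
  caratheodory_measurable (@vol R d.+1) S.
Proof.
move=> Sle Sge; apply: le_caratheodory_measurable => A.
apply: le_ereal_inf_tmp => _ [a [b [AS ->]]].
pose b' k : 'rV[R]_d.+1 :=
  \row_j if j == i then Num.min (b k ord0 i) t else b k ord0 j.
pose a' k : 'rV[R]_d.+1 :=
  \row_j if j == i then Num.max (a k ord0 i) t else a k ord0 j.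
apply: (@le_trans _ _ (\sum_(0 <= k <oo) (boxvol (a k) (b' k))%:E +
   \sum_(0 <= k <oo) (boxvol (a' k) (b k))%:E)%E).
  apply: leeD; apply: vol_cover => x [/AS [k _ xk] xS]; exists k => // j;
    have /andP[aj bj] := xk j; rewrite mxE; case: eqP => [ji|_]; rewrite ?aj ?bj//.
    by rewrite le_min -ji bj ji Sle.
  by rewrite ge_max -ji aj ji Sge.
rewrite -nneseriesD; last 2 first.
- by move=> k _ _; rewrite lee_fin boxvol_ge0.
- by move=> k _ _; rewrite lee_fin boxvol_ge0.
rewrite le_eqVlt; apply/orP; left; apply/eqP/eq_eseriesr => k _.
rewrite -EFinD; congr EFin; rewrite /boxvol.
rewrite (bigD1 i)//= [in X in _ + X](bigD1 i)//= [RHS](bigD1 i)//=.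
rewrite !mxE eqxx.
have -> : \prod_(j < d.+1 | j != i) Num.max (b' k ord0 j - a k ord0 j) 0
    = \prod_(j < d.+1 | j != i) Num.max (b k ord0 j - a k ord0 j) 0.
  by apply: eq_bigr => j /negbTE ji; rewrite mxE ji.
have -> : \prod_(j < d.+1 | j != i) Num.max (b k ord0 j - a' k ord0 j) 0
    = \prod_(j < d.+1 | j != i) Num.max (b k ord0 j - a k ord0 j) 0.
  by apply: eq_bigr => j /negbTE ji; rewrite mxE ji.
rewrite -mulrDl; congr (_ * _).
case: (leP (b k ord0 i) t) => bt; case: (leP (a k ord0 i) t) => at_.
all: rewrite ?maxEle ?minEle; do ?case: ifPn; lra.
Qed.

Definition cube {R : realType} (d : nat) (t : \bar R) : set 'rV[R]_d :=
  [set x | forall i, (`|x ord0 i|%:E <= t)%E].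

Lemma subset_cube {R : realType} {d : nat} (s t : \bar R) :
  (s <= t)%E -> cube d s `<=` cube d t.
Proof. by move=> st x xs i; apply: le_trans (xs i) st. Qed.

Lemma caratheodory_cube {R : realType} {d : nat} (t : R) :
  caratheodory_measurable (@vol R d.+1) (cube d.+1 t%:E).
Proof.
have -> : cube d.+1 t%:E = \big[setI/setT]_(i < d.+1)
   ([set x : 'rV[R]_d.+1 | x ord0 i <= t] `&`
    ~` [set x : 'rV[R]_d.+1 | x ord0 i < - t]).
  apply/seteqP; split => x.
    move=> xt; apply: (big_ind (fun S : set _ => S x)) => // i _; split => /=.
      by have := xt i; rewrite lee_fin ler_norml => /andP[].
    by have := xt i; rewrite lee_fin ler_norml => /andP[+ _]; rewrite leNgt => /negP.
  move=> xS i; move: xS; rewrite (bigD1 i)//= => -[[/= xt /negP xt'] _].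
  by rewrite lee_fin ler_norml xt leNgt xt'.
apply: big_ind.
- by rewrite -setC0; exact/caratheodory_measurable_setC/caratheodory_measurable_set0.
- by move=> S T; apply: caratheodory_measurable_setI.
move=> i _; apply: caratheodory_measurable_setI.
  apply: (@caratheodory_halfspace _ _ i t) => x /=; first by [].
  by move/negP; rewrite -ltNge => /ltW.
apply: caratheodory_measurable_setC.
apply: (@caratheodory_halfspace _ _ i (- t)) => x /=; first exact: ltW.
by move/negP; rewrite -leNgt.
Qed.

(** Continuity from below for an arbitrary [A]: the shells between consecutive cubes are disjoint
    and Caratheodory measurable, so the volumes of the pieces of [A] in them add up. *)
Lemma vol_le_cubes {R : realType} {d : nat} (A : set 'rV[R]_d.+1) (c : \bar R) :
  (forall N : nat, (vol (A `&` cube d.+1 N%:R%:E) <= c)%E) -> (vol A <= c)%E.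
Proof.
move=> Ac; pose C N := cube d.+1 (N%:R%:E : \bar R).
have mC : nondecreasing_seq C.
  by move=> m n mn; apply/subsetPset/subset_cube; rewrite lee_fin ler_nat.
have cC N : caratheodory_measurable (@vol R d.+1) (C N) by exact: caratheodory_cube.
pose D := seqD C.
have cD N : caratheodory_measurable (@vol R d.+1) (D N).
  by case: N => [|N]//=; apply: caratheodory_measurable_setD.
have UD : \bigcup_k D k = setT.
  rewrite eq_bigcup_seqD; apply/seteqP; split => // x _.
  pose M := \big[Num.max/0]_(i < d.+1) `|x ord0 i|.
  exists (Num.truncn M).+1 => // i; rewrite lee_fin.
  apply: le_trans (_ : M <= _); last exact/ltW/truncnS_gt.
  exact: le_bigmax.
have := outer_measure_bigcup_lim (@vol R d.+1) D A.
rewrite UD setIT => /le_trans; apply.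
apply: lime_le; first by apply: is_cvg_nneseries => n _ _; exact: vol_ge0.
apply: nearW => n; rewrite big_mkord.
rewrite -(caratheodory_additive cD (trivIset_seqD mC)).
apply: le_trans (Ac n); apply: le_vol; apply: setIS.
(* One more shell is added, so that the union is exactly the cube [C n], also for n = 0. *)
apply: (@subset_trans _ (\big[setU/set0]_(i < n.+1) D i)).
  by rewrite big_ord_recr; exact: subsetUl.
by rewrite (nondecreasing_bigsetU_seqD _ mC).
Qed.

(** * Convex sets and grids *)

Lemma convexP {R : realType} {d : nat} (C : set 'rV[R]_d) :
  convex C <-> forall x y t, C x -> C y -> 0 <= t -> t <= 1 ->
    C (t *: x + (1 - t) *: y).
Proof.
split=> [cC x y t Cx Cy t0 t1|cC x y t].
  by have := cC x y (Itv01 t0 t1); rewrite !inE; apply.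
rewrite !inE => Cx Cy; apply: cC => //.
Qed.

Definition orthant {R : realType} {d : nat} (s : {ffun 'I_d -> bool})
    (v : 'rV[R]_d) : set 'rV[R]_d :=
  [set x | forall i, if s i then v ord0 i <= x ord0 i else x ord0 i <= v ord0 i].

(* Coordinates of a point of C in each orthant are matched with those of v one
   at a time, by mixing two orthants that differ in that coordinate. *)
Lemma convex_meets_orthants {R : realType} {d : nat} (C : set 'rV[R]_d)
    (v : 'rV[R]_d) :
  convex C -> (forall s, exists2 x, C x & orthant s v x) -> C v.
Proof.
move=> /convexP cC Cs.
suff H k : (k <= d)%N -> forall s, exists2 x, C x & orthant s v x /\
    forall i : 'I_d, (i < k)%N -> x ord0 i = v ord0 i.
  have [x Cx [_ xv]] := H d (leqnn d) [ffun=> true].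
  by suff <- : x = v by []; apply/rowP => i; apply: xv.
elim: k => [_ s|k IH kd s]; first by have [x] := Cs s; exists x.
pose e : 'I_d := Ordinal kd.
pose sb b : {ffun 'I_d -> bool} := [ffun i => if i == e then b else s i].
have [x Cx [xs xv]] := IH (ltnW kd) (sb true).
have [y Cy [ys yv]] := IH (ltnW kd) (sb false).
have xe : v ord0 e <= x ord0 e by have := xs e; rewrite ffunE eqxx.
have ye : y ord0 e <= v ord0 e by have := ys e; rewrite ffunE eqxx.
have [t [t0 t1 te]] : exists t, [/\ 0 <= t, t <= 1 &
    t * x ord0 e + (1 - t) * y ord0 e = v ord0 e].
  have [xy|xy] := eqVneq (x ord0 e) (y ord0 e).
    exists 1; split => //.
    by rewrite subrr mul0r addr0 mul1r; apply: le_anti; rewrite xe xy ye.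
  have D0 : 0 < x ord0 e - y ord0 e.
    by rewrite subr_gt0 lt_neqAle eq_sym xy (le_trans ye xe).
  exists ((v ord0 e - y ord0 e) / (x ord0 e - y ord0 e)); split.
  - by rewrite divr_ge0 ?(ltW D0)// subr_ge0.
  - by rewrite ler_pdivrMr// mul1r lerB.
  - by field; rewrite gt_eqF.
exists (t *: x + (1 - t) *: y); first exact: cC.
have mix (i : 'I_d) : (t *: x + (1 - t) *: y) ord0 i =
   t * x ord0 i + (1 - t) * y ord0 i by rewrite !mxE.
have u0 : 0 <= 1 - t by rewrite subr_ge0.
split=> i; last first.
  rewrite ltnS leq_eqVlt => /orP[/eqP ik|ik].
    by have -> : i = e by [apply: val_inj]; rewrite mix.
  by rewrite mix xv// yv//; ring.
have [->|ie] := eqVneq i e; first by rewrite mix te; case: ifP.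
have := xs i; have := ys i; rewrite !ffunE (negbTE ie) mix; case: (s i) => yi xi.
- by have := ler_wpM2l t0 xi; have := ler_wpM2l u0 yi; lra.
- by have := ler_wpM2l t0 xi; have := ler_wpM2l u0 yi; lra.
Qed.

Definition cell (R : realType) {d M : nat} (z : {ffun 'I_d -> 'I_M}) :
    set 'rV[R]_d :=
  [set c | forall i, (z i)%:R / M%:R <= c ord0 i <= (z i).+1%:R / M%:R].

(* Moving in direction s, by at least one step, a cell that contains a point v
   outside of L lands in an orthant at v that misses L. *)
Lemma cell_shift {R : realType} {d : nat} (M : nat) (L : set 'rV[R]_d)
    (z z' : {ffun 'I_d -> 'I_M}) (s : {ffun 'I_d -> bool}) (v : 'rV[R]_d) (k : nat) :
  cell R z v -> L `&` orthant s v = set0 -> (0 < k)%N ->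
  (forall i, if s i then z' i = (z i + k)%N :> nat else z i = (z' i + k)%N :> nat) ->
  L `&` cell R z' = set0.
Proof.
move=> zv Ls k0 zz'; apply/seteqP; split => // x [Lx z'x].
suff : (L `&` orthant s v) x by rewrite Ls.
split=> // i; have /andP[v1 v2] := zv i; have /andP[x1 x2] := z'x i.
have Mi : 0 <= (M%:R : R)^-1 by rewrite invr_ge0.
have := zz' i; case: (s i) => E.
  apply: le_trans v2 (le_trans _ x1); apply: ler_wpM2r => //.
  by rewrite ler_nat E; lia.
apply: le_trans x2 (le_trans _ v1); apply: ler_wpM2r => //.
by rewrite ler_nat E; lia.
Qed.

Definition boundary_cells {R : realType} {d : nat} (M : nat)
    (L : set 'rV[R]_d) : {set {ffun 'I_d -> 'I_M}} :=
  finset (fun z : {ffun 'I_d -> 'I_M} =>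
    `[< L `&` cell R z !=set0 /\ ~ (cell R z `<=` L) >]).

(** A boundary cell has a point outside [L], hence a direction [s] whose orthant at that point
    misses [L]. Shifting the cell diagonally in direction [s] never gives a boundary cell again. So
    a boundary cell and a shift length below M are determined by the direction and the shifted
    position, for which there are 2^d and (2M)^d choices. *)
Lemma card_boundary_cells {R : realType} {d : nat} (M : nat)
    (L : set 'rV[R]_d) :
  convex L -> (#|boundary_cells M L| * M <= (4 * M) ^ d)%N.
Proof.
move=> cL; have [M0|M0] := posnP M.
  by rewrite [X in (_ * X)%N]M0 muln0.
have /choice[s Ps] : forall z : {ffun 'I_d -> 'I_M},
    exists s : {ffun 'I_d -> bool}, z \in boundary_cells M L ->
    exists v, cell R z v /\ L `&` orthant s v = set0.
  move=> z; have [zB|] := boolP (z \in boundary_cells M L); last first.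
    by exists [ffun=> true].
  move: zB; rewrite inE => /asboolP[_ /existsNP[v /not_implyP[zv Lv]]].
  apply: contrapT => /forallNP H; apply: Lv; apply: convex_meets_orthants => // s.
  apply: contrapT => Ls; apply: (H s) => _; exists v; split => //.
  by apply/seteqP; split => // x [Lx xs]; apply: Ls; exists x.
pose M2 := (2 * M)%N.
have M20 : (0 < M2)%N by rewrite /M2; lia.
(* Decreasing coordinates are offset by M to stay natural numbers. All coordinates are below 2M, so
   the remainder changes nothing. *)
pose h (p : {ffun 'I_d -> 'I_M} * 'I_M) :
    {ffun 'I_d -> bool} * {ffun 'I_d -> 'I_M2} :=
  (s p.1, [ffun i : 'I_d => Ordinal (ltn_pmod
    (if s p.1 i then p.1 i + p.2 else p.1 i + (M - p.2))%N M20)]).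
have hE z (k : 'I_M) i : val ((h (z, k)).2 i) =
    (if s z i then z i + k else z i + (M - k))%N.
  rewrite ffunE /= modn_small// /M2.
  by case: ifP => _; have := ltn_ord (z i); have := ltn_ord k; lia.
have step z z' (k k' : 'I_M) : z \in boundary_cells M L ->
    z' \in boundary_cells M L -> h (z, k) = h (z', k') -> ~ (k' < k)%N.
  move=> zB z'B hh kk'; have [v [zv Lv]] := Ps _ zB.
  have ss : s z = s z' by have := congr1 fst hh.
  have k'0 : (0 < k - k')%N by rewrite subn_gt0.
  move: z'B; rewrite inE => /asboolP[[x Lx] _].
  suff E : L `&` cell R z' = set0 by rewrite E in Lx.
  apply: (cell_shift _ _ _ _ _ _ _ zv Lv k'0) => i.
  have : val ((h (z, k)).2 i) = val ((h (z', k')).2 i) by rewrite hh.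
  rewrite !hE -ss.
  by case: (s z i) => /=; have := ltn_ord k; have := ltn_ord k'; lia.
have inj : {in finset.setX (boundary_cells M L) [set: 'I_M]%SET &, injective h}.
  move=> [z k] [z' k']; rewrite !finset.in_setX !finset.in_setT !andbT /= => zB z'B hh.
  have kk' : k = k'.
    have /negP := step z z' k k' zB z'B hh; rewrite -leqNgt => le1.
    have /negP := step z' z k' k z'B zB (esym hh); rewrite -leqNgt => le2.
    by apply: val_inj; apply/eqP; rewrite eqn_leq le1.
  rewrite -kk' in hh *; congr (_, _); apply/ffunP => i; apply: val_inj.
  have ss : s z = s z' by have := congr1 fst hh.
  have : val ((h (z, k)).2 i) = val ((h (z', k)).2 i) by rewrite hh.
  rewrite !hE -ss.
  by case: (s z i) => /=; have := ltn_ord k; lia.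
have := leq_card_in _ _ inj.
rewrite cardsX cardsT card_ord card_prod !card_ffun !card_ord card_bool.
by rewrite -expnMn /M2 mulnA.
Qed.

Definition para {R : realType} {d : nat} (p : 'rV[R]_d) (P : 'M[R]_d) :
    set 'rV[R]_d :=
  [set p + c *m P | c in box 0 (const_mx 1)].

Definition para_cell {R : realType} {d M : nat} (p : 'rV[R]_d) (P : 'M[R]_d)
    (z : {ffun 'I_d -> 'I_M}) : set 'rV[R]_d :=
  [set p + c *m P | c in cell R z].

(** The first parallelepiped is the image of the second under a homothety and a translation. *)
Lemma vol_para_scale {R : realType} {d : nat} (p q : 'rV[R]_d) (P : 'M[R]_d)
    (c : R) :
  0 < c -> (vol (para p (c *: P)) <= (c ^+ d)%:E * vol (para q P))%E.
Proof.
move=> c0; apply: le_trans (vol_affine_le (p - c *: q) c (para q P) c0).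
apply: le_vol => _ [x xU <-]; exists (q + x *m P); first by exists x.
by rewrite scalerDr addrA subrK -scalemxAr.
Qed.

Lemma vol_para_cell {R : realType} {d M : nat} (p : 'rV[R]_d) (P : 'M[R]_d)
    (z : {ffun 'I_d -> 'I_M}) :
  (0 < M)%N ->
  (vol (para_cell p P z) <= (M%:R ^- d)%:E * vol (para p P))%E.
Proof.
move=> M0; have M0R : 0 < (M%:R : R) by rewrite ltr0n.
pose q : 'rV[R]_d := p + (\row_i ((z i)%:R / M%:R)) *m P.
rewrite -exprVn.
apply: le_trans (_ : (vol (para q (M%:R^-1 *: P)) <= _)%E); last first.
  by apply: vol_para_scale; rewrite invr_gt0.
apply: le_vol => _ [c cz <-].
exists (M%:R *: (c - \row_i ((z i)%:R / M%:R))).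
  move=> i; have /andP[c1 c2] := cz i; rewrite !mxE.
  apply/andP; split; first by rewrite mulr_ge0 ?(ltW M0R)// subr_ge0.
  rewrite -ler_pdivlMl// mulr1 lerBlDr; apply: le_trans c2 _.
  by rewrite -natr1 mulrDl mul1r addrC.
rewrite /q -scalemxAr -scalemxAl scalerA mulVf ?gt_eqF// scale1r mulmxBl.
by rewrite [c *m P - _]addrC addrA addrK.
Qed.

Lemma convex_preimage {R : realType} {d : nat} (p : 'rV[R]_d) (P : 'M[R]_d)
    (A : set 'rV[R]_d) :
  convex A -> convex [set c | A (p + c *m P)].
Proof.
move=> /convexP cA; apply/convexP => x y t /= Ax Ay t0 t1.
have -> : p + (t *: x + (1 - t) *: y) *m P =
    t *: (p + x *m P) + (1 - t) *: (p + y *m P).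
  rewrite !scalerDr mulmxDl -!scalemxAl addrACA -scalerDl.
  by rewrite [t + _]addrC subrK scale1r.
exact: cA.
Qed.

Lemma box_cover_cells {R : realType} {d M : nat} (c : 'rV[R]_d) :
  (0 < M)%N -> box 0 (const_mx 1) c ->
  exists z : {ffun 'I_d -> 'I_M}, cell R z c.
Proof.
move=> M0 cU; have M0R : 0 < (M%:R : R) by rewrite ltr0n.
(* The minimum puts a coordinate equal to 1 into the last cell. *)
have Hm i : (minn (Num.truncn (M%:R * c ord0 i)) M.-1 < M)%N.
  by rewrite -(ltn_predK M0) ltnS geq_minr.
exists [ffun i => Ordinal (Hm i)] => i; rewrite ffunE /=.
have := cU i; rewrite !mxE => /andP[c0 c1].
have Mc0 : 0 <= M%:R * c ord0 i by rewrite mulr_ge0// ltW.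
rewrite ler_pdivrMr// ler_pdivlMr// [c ord0 i * _]mulrC.
have /andP[t1 t2] := truncn_itv Mc0.
apply/andP; split.
  by apply: le_trans t1; rewrite ler_nat geq_minl.
rewrite /minn; case: ifP => _; first exact: ltW.
by rewrite (ltn_predK M0) ler_piMr// ltW.
Qed.

Definition inner_cells {R : realType} {d : nat} (M : nat) (p : 'rV[R]_d)
    (P : 'M[R]_d) (A : set 'rV[R]_d) : {set {ffun 'I_d -> 'I_M}} :=
  finset (fun z : {ffun 'I_d -> 'I_M} => `[< para_cell p P z `<=` A >]).

(** A cell that meets [A] without lying in it comes from a boundary cell of the preimage of [A].
    There are at most 4^D M^(D-1) of these, with D the dimension, and each has at most the fraction
    M^(-D) of the volume of the parallelepiped. *)
Lemma vol_inner_cells {R : realType} {d : nat} (M : nat) (p : 'rV[R]_d.+1)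
    (P : 'M[R]_d.+1) (A : set 'rV[R]_d.+1) :
  (0 < M)%N -> convex A -> A `<=` para p P ->
  (vol A <= vol (\big[setU/set0]_(z in inner_cells M p P A) para_cell p P z)
     + (4 ^+ d.+1 / M%:R)%:E * vol (para p P))%E.
Proof.
move=> M0 cA AP; have M0R : 0 < (M%:R : R) by rewrite ltr0n.
pose L := [set c | A (p + c *m P)].
have cL : convex L by exact: convex_preimage.
pose B := boundary_cells M L.
apply: (@le_trans _ _ (vol ((\big[setU/set0]_(z in inner_cells M p P A)
    para_cell p P z) `|` (\big[setU/set0]_(z in B) para_cell p P z)))).
  apply: le_vol => x Ax; have [c cU cx] := AP x Ax.
  have [z cz] := box_cover_cells c M0 cU.
  have [zA|zA] := pselect (para_cell p P z `<=` A).
    have zI : z \in inner_cells M p P A by rewrite inE; apply/asboolP.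
    by left; rewrite (bigD1 z zI); left; exists c.
  have zB : z \in B.
    rewrite inE; apply/asboolP; split.
      by exists c; split => //; rewrite /L /= cx.
    by move=> zL; apply: zA => _ [c' c'z <-]; exact: zL.
  by right; rewrite (bigD1 z zB); left; exists c.
apply: le_trans (outer_measureU2 _ _ _) _.
apply: leeD => //; apply: le_trans (vol_bigsetU_le _ _ _ _) _.
apply: le_trans (_ : (\sum_(z in B) (M%:R ^- d.+1)%:E * vol (para p P) <= _)%E).
  by apply: lee_sum => z _; exact: vol_para_cell.
rewrite -ge0_sume_distrl; last first.
  by move=> z _; rewrite lee_fin invr_ge0 exprn_ge0.
apply: lee_wpmul2r; first exact: vol_ge0.
rewrite sumEFin lee_fin sumr_const -[_ *+ _]mulr_natl.
have := card_boundary_cells M L cL; rewrite -/B expnMn => HB.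
have {}HB : #|B|%:R * M%:R <= 4 ^+ d.+1 * M%:R ^+ d.+1 :> R.
  by rewrite -!natrX -!natrM ler_nat.
by rewrite ler_pdivrMr ?exprn_gt0// mulrAC ler_pdivlMr.
Qed.

(** * Bounding parallelepipeds *)

Lemma vol_fin_cube {R : realType} {d : nat} (N : R) (A : set 'rV[R]_d.+1) :
  A `<=` cube d.+1 N%:E -> vol A \is a fin_num.
Proof.
move=> AN; rewrite ge0_fin_numE ?vol_ge0//.
apply: le_lt_trans (ltry (boxvol (const_mx (- N)) (const_mx N : 'rV[R]_d.+1))).
apply: le_trans (vol_box_le _ _); apply: le_vol => x /AN xN i.
by rewrite !mxE -ler_norml -lee_fin.
Qed.

Lemma cube_sub_para {R : realType} {d : nat} (N : R) :
  0 < N -> cube d N%:E `<=` para (const_mx (- N)) (N *+ 2)%:M.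
Proof.
move=> N0 x xN; have N20 : 0 < N *+ 2 by rewrite pmulrn_lgt0.
exists ((N *+ 2)^-1 *: (x + const_mx N)); last first.
  rewrite mul_mx_scalar scalerA divff ?gt_eqF// scale1r addrC -addrA.
  by apply/rowP => i; rewrite !mxE subrr addr0.
move=> i; have := xN i; rewrite lee_fin ler_norml => /andP[x1 x2].
rewrite !mxE mulr_ge0 ?invr_ge0 ?(ltW N20)//=; last lra.
rewrite mulrC ler_pdivrMr// mulr2n; lra.
Qed.

(** On a fine enough grid the volume lost at the boundary is less than that of [A], so [A] contains
    a whole cell; [p] is its lowest corner and [s] its side. *)
Lemma convex_corner {R : realType} {d : nat} (N : R) (A : set 'rV[R]_d.+1) :
  convex A -> A `<=` cube d.+1 N%:E -> (0 < vol A)%E ->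
  exists p (s : R), [/\ 0 < s, A p & forall i, A (p + row i s%:M)].
Proof.
move=> cA AN vA.
have [N1 [N10 {}AN]] : exists N1 : R, 0 < N1 /\ A `<=` cube d.+1 N1%:E.
  exists (Num.max N 1); split; first by rewrite lt_max ltr01 orbT.
  by apply: subset_trans AN _; apply: subset_cube; rewrite lee_fin le_max lexx.
pose p : 'rV[R]_d.+1 := const_mx (- N1); pose P : 'M[R]_d.+1 := (N1 *+ 2)%:M.
have AP : A `<=` para p P by apply: subset_trans AN _; exact: cube_sub_para.
have Pfin : vol (para p P) \is a fin_num.
  apply: (@vol_fin_cube _ _ (N1 *+ 3)) => _ [c cU <-] i.
  have := cU i; rewrite mul_mx_scalar !mxE lee_fin ler_norml => /andP[c0 c1].
  have := ler_wpM2l (ltW N10) c1; have := mulr_ge0 (ltW N10) c0.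
  by rewrite mulr1 !mulrnAl; lra.
have Afin := vol_fin_cube _ _ AN.
pose v := fine (vol (para p P)); pose a := fine (vol A).
have a0 : 0 < a by apply: fine_gt0; rewrite vA -ge0_fin_numE ?vol_ge0.
pose M := (Num.truncn (4 ^+ d.+1 * v / a)).+1.
have aM : 4 ^+ d.+1 / M%:R * v < a.
  rewrite mulrAC ltr_pdivrMr ?ltr0n// [a * _]mulrC -ltr_pdivrMr//.
  exact: truncnS_gt.
have [E|/set0Pn[z]] := eqVneq (inner_cells M p P A) finset.set0.
  have := @vol_inner_cells R d M p P A (ltn0Sn _) cA AP.
  rewrite E big_set0 vol0 add0e -(fineK Afin) -(fineK Pfin) -/v -/a -EFinM.
  by rewrite lee_fin leNgt aM.
rewrite inE => /asboolP zA; have M0 : 0 < (M%:R : R) by rewrite ltr0n.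
pose c : 'rV[R]_d.+1 := \row_i ((z i)%:R / M%:R).
exists (p + c *m P), (M%:R^-1 * (N1 *+ 2)); split.
- by rewrite mulr_gt0 ?invr_gt0// pmulrn_lgt0.
- apply: zA; exists c => // i; rewrite mxE lexx/=.
  by rewrite ler_pM2r ?invr_gt0// ler_nat.
- move=> j; apply: zA; exists (c + row j (M%:R^-1)%:M); last first.
    rewrite mulmxDl addrA; congr (_ + _).
    by rewrite -row_mul -scalar_mxM.
  move=> i; rewrite !mxE -natr1 mulrDl mul1r lerDl lerD2l.
  by rewrite mulrb; case: ifP => _; rewrite ?lexx ?invr_ge0 ?ler0n.
Qed.

(** Leibniz formula. It makes the supremum of determinants in [bounding_para] finite. *)
Lemma norm_det_le {R : realType} {n : nat} (B : R) (P : 'M[R]_n) :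
  (forall i j, `|P i j| <= B) -> `|\det P| <= (n`!)%:R * B ^+ n.
Proof.
move=> PB; apply: le_trans (ler_norm_sum _ _ _) _.
apply: le_trans (_ : \sum_(s : 'S_n) B ^+ n <= _).
  apply: ler_sum => s _; rewrite normrM normrX normrN1 expr1n mul1r normr_prod.
  apply: le_trans (_ : \prod_(i < n) B <= _).
    by apply: ler_prod => i _; rewrite normr_ge0 PB.
  by rewrite prodr_const card_ord.
by rewrite sumr_const card_Sn mulr_natl.
Qed.

Definition set_row {R : realType} {n : nat} (i : 'I_n) (y : 'rV[R]_n)
    (P : 'M[R]_n) : 'M[R]_n :=
  \matrix_k (if k == i then y else row k P).

(** Cramer's rule for row vectors: replacing row [i] does not change the cofactors along that
    row. *)
Lemma cramer_row {R : realType} {n : nat} (P : 'M[R]_n) (y : 'rV[R]_n) :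
  \det P != 0 -> y = (\row_i (\det (set_row i y P) / \det P)) *m P.
Proof.
move=> P0; have Pu : P \in unitmx by rewrite unitmxE unitfE.
rewrite -[LHS]mulmx1 -(mulVmx Pu) mulmxA; congr (_ *m _).
apply/rowP => i; rewrite [RHS]mxE /invmx Pu -scalemxAr mxE mulrC; congr (_ / _).
rewrite mxE (expand_det_row _ i); apply: eq_bigr => j _.
rewrite !mxE eqxx; congr (_ * _); rewrite /cofactor; congr (_ * \det _).
by apply/matrixP => k l; rewrite !mxE eq_sym (negbTE (neq_lift i k)) mxE.
Qed.

Lemma convex_mean {R : realType} {d : nat} (A : set 'rV[R]_d)
    (x : nat -> 'rV[R]_d) (k : nat) :
  convex A -> (forall i, A (x i)) -> A (k.+1%:R^-1 *: \sum_(i < k.+1) x i).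
Proof.
move=> /convexP cA Ax; elim: k => [|k IH].
  by rewrite big_ord1 invr1 scale1r.
have k0 : (k.+2%:R : R) != 0 by rewrite pnatr_eq0.
have k1 : (k.+1%:R : R) != 0 by rewrite pnatr_eq0.
have -> : k.+2%:R^-1 *: \sum_(i < k.+2) x i = (k.+1%:R / k.+2%:R) *:
   (k.+1%:R^-1 *: \sum_(i < k.+1) x i) + (1 - k.+1%:R / k.+2%:R) *: x k.+1.
  rewrite big_ord_recr scalerDr scalerA /=; congr (_ *: _ + _ *: _).
    by rewrite mulrAC divff// mul1r.
  by apply: (mulIf k0); rewrite mulrBl mul1r mulVf// divfK// -natrB// subSnn.
apply: cA => //.
by rewrite ler_pdivrMr ?ltr0n// mul1r ler_nat.
Qed.

(** A point of the shrunken parallelepiped is the mean of the points p + c_i row_i(P), each on the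
    segment from [p] to p + row_i(P). *)
Lemma convex_para_sub {R : realType} {d : nat} (A : set 'rV[R]_d.+1)
    (p : 'rV[R]_d.+1) (P : 'M[R]_d.+1) :
  convex A -> A p -> (forall i, A (p + row i P)) ->
  para p (d.+1%:R^-1 *: P) `<=` A.
Proof.
move=> cA Ap Ai _ [c cU <-].
pose x k : 'rV[R]_d.+1 := p + c ord0 (inord k) *: row (inord k) P.
suff -> : p + c *m (d.+1%:R^-1 *: P) = d.+1%:R^-1 *: \sum_(i < d.+1) x i.
  apply: convex_mean => // i; rewrite /x; set j := inord i.
  have := cU j; rewrite !mxE => /andP[c0 c1].
  have -> : p + c ord0 j *: row j P =
     c ord0 j *: (p + row j P) + (1 - c ord0 j) *: p.
    by rewrite scalerDr addrAC -scalerDl [_ + (1 - _)]addrC subrK scale1r.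
  by move/convexP : cA; apply.
rewrite big_split /= sumr_const card_ord -(scaler_nat d.+1 p) scalerDr scalerA.
rewrite mulVf ?pnatr_eq0// scale1r -scalemxAr mulmx_sum_row; congr (_ + _ *: _).
by apply: eq_bigr => i _; rewrite inord_val.
Qed.

(* P spans a simplex of nearly maximal volume in A, so that by Cramer's rule
   the points of A have coordinates in [-2, 2]. *)
Lemma bounding_para {R : realType} {d : nat} (N : R) (A : set 'rV[R]_d.+1) :
  convex A -> A `<=` cube d.+1 N%:E -> (0 < vol A)%E ->
  exists p P, A `<=` para p P /\
    (vol (para p P) <= ((4 * d.+1%:R) ^+ d.+1)%:E * vol A)%E.
Proof.
move=> cA AN vA.
pose D : set R := [set r | exists p P,
  [/\ A p, forall i, A (p + row i P) & r = `|\det P|]].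
have [p0 [s [s0 Ap0 As]]] := convex_corner _ _ cA AN vA.
have Ds : D (s ^+ d.+1).
  by exists p0, s%:M; rewrite det_scalar normrX gtr0_norm.
have ubD : ubound D ((d.+1)`!%:R * (N *+ 2) ^+ d.+1).
  move=> _ [p [P [Ap AP ->]]]; apply: norm_det_le => i j.
  have := AN _ (AP i) j; have := AN _ Ap j; rewrite !lee_fin !mxE.
  by rewrite !ler_norml; lra.
have sD : has_sup D.
  by split; [exists (s ^+ d.+1)|exists ((d.+1)`!%:R * (N *+ 2) ^+ d.+1)].
have sup0 : 0 < sup D.
  by apply: lt_le_trans (exprn_gt0 d.+1 s0) _; apply: ub_le_sup => //; case: sD.
(* The supremum may not be attained; half of it is enough and accounts for the bound 2 on the
   coordinates. *)
have h0 : 0 < sup D / 2 by lra.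
have [_ [p [P [Ap AP ->]]] supP] := sup_adherent h0 sD.
have {}supP : sup D < 2 * `|\det P| by lra.
have P0 : \det P != 0.
  by apply/eqP => E; move: supP; rewrite E normr0 mulr0; lra.
(* The translation by 2 and the factor 4 carry coordinates in [-2, 2] to [0, 1]. *)
exists (p - (const_mx 2 : 'rV_ _) *m P), (4 *: P); split.
  move=> y Ay; pose c := \row_i (\det (set_row i (y - p) P) / \det P).
  have yc : y - p = c *m P by exact: cramer_row.
  have c2 i : `|c ord0 i| <= 2.
    rewrite mxE normrM normfV ler_pdivrMr ?normr_gt0//.
    apply: le_trans (ltW supP); apply: ub_le_sup; first by case: sD.
    exists p, (set_row i (y - p) P); split => // k.
    by rewrite rowK; case: ifP => _; rewrite ?subrKC//; apply: AP.
  exists (4^-1 *: (c + const_mx 2)).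
    move=> i; have := c2 i; rewrite !mxE ler_norml => /andP[]; lra.
  rewrite -scalemxAl -scalemxAr scalerA mulVf ?pnatr_eq0// scale1r mulmxDl.
  by rewrite -yc addrC addrACA subrK subrr addr0.
(* The parallelepiped spanned by P / (d+1) lies in [A], and the bounding one is larger by the factor
   4(d+1). *)
have -> : 4 *: P = (4 * d.+1%:R) *: (d.+1%:R^-1 *: P).
  by rewrite scalerA mulfK ?pnatr_eq0.
apply: le_trans (vol_para_scale _ p _ _ (_ : 0 < 4 * d.+1%:R)) _.
  by rewrite mulr_gt0 ?ltr0n.
apply: lee_wpmul2l; first by rewrite lee_fin exprn_ge0 ?mulr_ge0.
by apply: le_vol; apply: convex_para_sub.
Qed.

(** * Common parts and heights *)

Lemma card_max_fiber {I T : finType} (g : I -> T) (J : {set I}) :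
  (0 < #|J|)%N ->
  exists t, (#|J| <= #|T| * #|[set j in J | g j == t]|)%N.
Proof.
move=> /card_gt0P[j0 _].
exists [arg max_(t > g j0) #|[set j in J | g j == t]|]%N.
case: arg_maxnP => // t _ tmax.
rewrite -sum1_card (partition_big g predT)//= -sum_nat_const.
apply: leq_sum => u _; apply: leq_trans (tmax u isT).
by rewrite sum1dep_card; apply: subset_leq_card; apply/fintype.subsetP => j; rewrite !inE.
Qed.

(** Sort the indices by the set of cells contained in the intersection of [K] and [C j], and keep
    the most frequent set: its cells lie in every [C j] of that class. The loss is the boundary term
    for a parallelepiped of volume at most (4(d+1))^(d+1) * 2. The bound [N] does not enter the
    estimates, so it may depend on the family. *)
Lemma vol_common_part {R : realType} {d M : nat} {I : finType} (N : R)
    (K : set 'rV[R]_d.+1) (C : I -> set 'rV[R]_d.+1) (J : {set I}) (w : R) :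
  (0 < M)%N -> convex K -> K `<=` cube d.+1 N%:E -> (vol K <= 2%:E)%E ->
  (forall j, convex (C j)) -> 0 < w ->
  (forall j, j \in J -> (w%:E <= vol (K `&` C j))%E) -> (0 < #|J|)%N ->
  exists S : {set I},
    (#|J| <= #|{: {set {ffun 'I_d.+1 -> 'I_M}}}| * #|S|)%N /\
    ((w - 4 ^+ d.+1 / M%:R * ((4 * d.+1%:R) ^+ d.+1 * 2))%:E
       <= vol (\bigcap_(j in [set j | j \in S]) C j))%E.
Proof.
move=> M0 cK KN K2 cC w0 Jw J0.
have cKC j : convex (K `&` C j).
  apply/convexP => x y t [Kx Cx] [Ky Cy] t0 t1; split.
    by move/convexP : cK; apply.
  by have /convexP := cC j; apply.
have vK : (0 < vol K)%E.
  have [j jJ] := card_gt0P J0.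
  apply: lt_le_trans (_ : w%:E <= _)%E; first by rewrite lte_fin.
  by apply: le_trans (Jw j jJ) _; apply: le_vol; exact: subIsetl.
have [p [P [KP vP]]] := bounding_para N K cK KN vK.
pose g j := inner_cells M p P (K `&` C j).
have [t tJ] := card_max_fiber g J J0.
exists [set j in J | g j == t]; split => //.
set S := finset _ in tJ *.
have S0 : (0 < #|S|)%N.
  by move: J0 => /leq_trans/(_ tJ); rewrite muln_gt0 => /andP[].
have [j] := card_gt0P S0; rewrite inE => /andP[jJ /eqP gj].
have := @vol_inner_cells R d M p P (K `&` C j) M0 (cKC j)
  (subset_trans (@subIsetl _ _ _) KP).
move=> /(le_trans (Jw j jJ)); rewrite -/(g j) gj => Hw.
have sub : \big[setU/set0]_(z in t) para_cell p P z `<=`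
    \bigcap_(j in [set j | j \in S]) C j.
  move=> x xt i /=; rewrite inE => /andP[_ /eqP gi].
  move: xt; rewrite -gi; elim/big_rec : _ => // z X.
  by rewrite inE => /asboolP zKC IH [/zKC[]|/IH].
rewrite EFinB leeBlDr//; apply: le_trans Hw _.
apply: leeD; first exact: le_vol.
rewrite [leRHS]EFinM; apply: lee_wpmul2l; first by rewrite lee_fin divr_ge0 ?exprn_ge0.
apply: le_trans vP _; rewrite [leRHS]EFinM; exact: lee_wpmul2l.
Qed.

Lemma vol_cube0 {R : realType} {d : nat} (A : set 'rV[R]_d.+1) :
  vol (A `&` cube d.+1 0%:E) = 0%E.
Proof.
apply/eqP; rewrite eq_le vol_ge0 andbT.
apply: (@le_trans _ _ (vol (box (0 : 'rV[R]_d.+1) 0))).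
  apply: le_vol => x [_ x0] i; have := x0 i.
  by rewrite lee_fin normr_le0 => /eqP ->; rewrite mxE lexx.
apply: le_trans (vol_box_le _ _) _; rewrite lee_fin /boxvol big_ord_recl.
by rewrite subrr maxxx mul0r.
Qed.

(** The shell between the two cubes is covered by 2(d+1) slabs of thickness [e], one for each
    face. *)
Lemma vol_cube_shell {R : realType} {d : nat} (N s e : R) (A : set 'rV[R]_d.+1) :
  0 <= N -> 0 <= e -> s + e <= N ->
  (vol (A `&` cube d.+1 (s + e)%:E) <= vol (A `&` cube d.+1 s%:E) +
    ((N *+ 2) ^+ d * e *+ (2 * d.+1))%:E)%E.
Proof.
move=> N0 e0 sN.
pose lo (i : 'I_d.+1) (b : bool) : 'rV[R]_d.+1 :=
  \row_j if j == i then if b then s else - (s + e) else - N.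
pose hi (i : 'I_d.+1) (b : bool) : 'rV[R]_d.+1 :=
  \row_j if j == i then if b then s + e else - s else N.
have volS i b : (vol (box (lo i b) (hi i b)) <= ((N *+ 2) ^+ d * e)%:E)%E.
  apply: le_trans (vol_box_le _ _) _; rewrite lee_fin /boxvol (bigD1 i)//=.
  rewrite !mxE eqxx.
  have -> : \prod_(j < d.+1 | j != i) Num.max (hi i b ord0 j - lo i b ord0 j) 0
     = (N *+ 2) ^+ d.
    rewrite (eq_bigr (fun=> N *+ 2)); last first.
      move=> j /negbTE ji; rewrite !mxE ji opprK -mulr2n.
      by apply/max_idPl; rewrite mulrn_wge0.
    by rewrite prodr_const cardC1 card_ord.
  rewrite mulrC; apply: ler_wpM2l; first by rewrite exprn_ge0// mulrn_wge0.
  by rewrite ge_max e0 andbT; case: b; lra.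
apply: (@le_trans _ _ (vol ((A `&` cube d.+1 s%:E) `|`
   \big[setU/set0]_(ib : 'I_d.+1 * bool) box (lo ib.1 ib.2) (hi ib.1 ib.2)))).
  apply: le_vol => x [Ax xse].
  have [xs|/existsNP[i /negP xs]] := pselect (cube d.+1 s%:E x); first by left.
  right; pose b := 0 <= x ord0 i; rewrite (bigD1 (i, b))//=; left => j.
  have := xse j; rewrite lee_fin ler_norml !mxE => /andP[x1 x2].
  case: eqP => [ji|_]; last by apply/andP; split; lra.
  move: xs; rewrite ji in x1 x2 *; rewrite lee_fin -ltNge /b.
  by case: (lerP 0 (x ord0 i)) => x0;
    [rewrite ger0_norm//|rewrite ltr0_norm//]; lra.
apply: le_trans (outer_measureU2 _ _ _) _; apply: leeD => //.
apply: le_trans (vol_bigsetU_le _ _ _ _) _.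
apply: le_trans (_ : (\sum_(ib : 'I_d.+1 * bool) ((N *+ 2) ^+ d * e)%:E <= _)%E).
  by apply: lee_sum => ib _; exact: volS.
by rewrite sumEFin sumr_const card_prod card_ord card_bool mulnC.
Qed.

Lemma vol_gt_cube {R : realType} {d : nat} (A : set 'rV[R]_d.+1) (c : \bar R) :
  (c < vol A)%E -> exists N : nat, (c < vol (A `&` cube d.+1 N%:R%:E))%E.
Proof.
rewrite ltNge => /negP cA; apply: contrapT => /forallNP H; apply: cA.
by apply: vol_le_cubes => N; rewrite leNgt; apply/negP; exact: H.
Qed.

(** A discrete intermediate value argument: among heights so close that each step adds volume at
    most 1, take the first one that reaches volume 1. *)
Lemma exists_height {R : realType} {d : nat} (A : set 'rV[R]_d.+1) :
  (1%:E <= vol A)%E -> exists t : \bar R,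
    (1%:E <= vol (A `&` cube d.+1 t))%E /\ (vol (A `&` cube d.+1 t) <= 2%:E)%E.
Proof.
move=> A1; have [A2|A2] := leP (vol A) 2%:E.
  exists +oo%E; suff -> : A `&` cube d.+1 +oo%E = A by [].
  by apply/seteqP; split => [x []//|x Ax]; split => // i; rewrite leey.
have [|N AN] := @vol_gt_cube _ _ A 1%:E.
  by apply: lt_trans A2; rewrite lte_fin; lra.
(* [B / m] is the bound of [vol_cube_shell] for one step of length N / m. *)
pose B : R := (N%:R *+ 2) ^+ d * N%:R *+ (2 * d.+1).
have B0 : 0 <= B by rewrite mulrn_wge0// mulr_ge0 ?exprn_ge0// mulrn_wge0.
pose m := (Num.truncn B).+1; have m0 : 0 < (m%:R : R) by rewrite ltr0n.
have Bm : B / m%:R <= 1 by rewrite ler_pdivrMr// mul1r ltW// truncnS_gt.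
pose tk k : R := k%:R * (N%:R / m%:R).
have exk : exists k, `[< (1%:E <= vol (A `&` cube d.+1 (tk k)%:E))%E >].
  by exists m; apply/asboolP; rewrite /tk mulrC divfK ?gt_eqF// ltW.
have e0 : 0 <= (N%:R / m%:R : R) by rewrite divr_ge0// ltW.
have [k /asboolP k1 kmin] := ex_minnP exk.
exists (tk k)%:E; split => //.
case: k k1 kmin => [|k] k1 kmin.
  by move: k1; rewrite /tk mul0r vol_cube0 lee_fin ler10.
have km : (k.+1 <= m)%N.
  by apply: kmin; apply/asboolP; rewrite /tk mulrC divfK ?gt_eqF// ltW.
have lt1 : (vol (A `&` cube d.+1 (tk k)%:E) < 1%:E)%E.
  rewrite ltNge; apply/negP => H.
  by have := kmin k (introT (asboolP _) H); rewrite ltnn.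
have tkS : tk k.+1 = tk k + N%:R / m%:R by rewrite /tk -natr1 mulrDl mul1r.
have tkN : tk k + N%:R / m%:R <= N%:R.
  by rewrite -tkS /tk mulrC mulrAC ler_pdivrMr// ler_wpM2l// ler_nat.
rewrite tkS; apply: le_trans (vol_cube_shell N%:R _ _ A (ler0n _ _) e0 tkN) _.
rewrite -[2]/(1 + 1) EFinD; apply: leeD; first exact: ltW.
rewrite lee_fin; apply: le_trans Bm; rewrite /B.
by rewrite mulrA -mulrnAl -mulrnAl mulrnAl mulrnAl.
Qed.

Lemma convex_cube {R : realType} {d : nat} (t : \bar R) : convex (cube d t).
Proof.
apply/convexP => x y k xt yt k0 k1 i.
(* A real bound replaces [t], which may be infinite. *)
have [m mt xym] : exists2 m : R, (m%:E <= t)%E &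
    `|x ord0 i| <= m /\ `|y ord0 i| <= m.
  exists (Num.max `|x ord0 i| `|y ord0 i|); last first.
    by rewrite !le_max !lexx orbT.
  by rewrite maxEle; case: ifP.
apply: le_trans mt; rewrite lee_fin !mxE; case: xym => xm ym.
apply: le_trans (ler_normD _ _) _; rewrite !normrM (ger0_norm k0).
rewrite (@ger0_norm _ (1 - k)) ?subr_ge0//.
have k1' : 0 <= 1 - k by rewrite subr_ge0.
by have := ler_wpM2l k0 xm; have := ler_wpM2l k1' ym; lra.
Qed.

Lemma convexI {R : realType} {d : nat} (A B : set 'rV[R]_d) :
  convex A -> convex B -> convex (A `&` B).
Proof.
move=> /convexP cA /convexP cB; apply/convexP => x y t [Ax Bx] [Ay By] t0 t1.
by split; [exact: cA|exact: cB].
Qed.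

Lemma convex_bigcap {R : realType} {d : nat} {I : Type} (D : set I)
    (F : I -> set 'rV[R]_d) :
  (forall i, convex (F i)) -> convex (\bigcap_(i in D) F i).
Proof.
move=> cF; apply/convexP => x y t xF yF t0 t1 i Di.
by have /convexP := cF i; apply => //; [exact: xF|exact: yF].
Qed.

(** The property defining w(d) is applied to [H], placed at index 0, followed by an enumeration of
    [T]. *)
Lemma wprop_extra {R : realType} {d n : nat} (w : R) (F : 'I_n -> set 'rV[R]_d)
    (T : {set 'I_n}) (H : set 'rV[R]_d) :
  wprop d w -> (forall i, convex (F i)) -> convex H -> #|T| = (2 * d)%N ->
  (1%:E <= vol (\bigcap_(i in [set i | i \in T]) F i))%E ->
  (forall i, i \in T ->
    (1%:E <= vol ((\bigcap_(j in [set j | j \in (T :\ i)%SET]) F j) `&` H))%E) ->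
  (w%:E <= vol ((\bigcap_(i in [set i | i \in T]) F i) `&` H))%E.
Proof.
move=> wd cF cH T2d T1 TH.
pose e (k : 'I_(2 * d)) : 'I_n := enum_val (cast_ord (esym T2d) k).
have eT k : e k \in T by exact: enum_valP.
have einj : injective e by move=> k l /enum_val_inj/cast_ord_inj.
pose G j := if unlift ord0 j is Some k then F (e k) else H.
apply: le_trans (_ : vol (\bigcap_j G j) <= _)%E.
  apply: wd => [j|j]; first by rewrite /G; case: unliftP.
  have [k ->|->] := unliftP ord0 j.
    apply: le_trans (TH (e k) (eT k)) _; apply: le_vol => x [xF xH] l.
    rewrite /= /G; case: unliftP => // k' -> kk'.
    apply: xF => /=; rewrite !inE eT andbT.
    by apply/eqP => /einj E; move: kk' => /=; rewrite E eqxx.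
  apply: le_trans T1 _; apply: le_vol => x xF l.
  rewrite /= /G; case: unliftP => [k' _ _|->]; first by apply: xF => /=.
  by rewrite eqxx.
apply: le_vol => x xG; split; last first.
  by have := xG ord0 I; rewrite /G unlift_none.
move=> i /= iT; have := xG (lift ord0 (cast_ord T2d (enum_rank_in iT i))) I.
by rewrite /G liftK /e cast_ordK enum_rankK_in.
Qed.

(** * Counting *)

Lemma exists_max {I : finType} {d : Order.disp_t} {T : orderType d} (f : I -> T)
    (A : {set I}) :
  (0 < #|A|)%N ->
  exists2 i, i \in A & forall j, j \in A -> (f j <= f i)%O.
Proof.
move=> /card_gt0P[i0 i0A]; exists [arg max_(i > i0 in A) f i]%O.
  by case: arg_maxP.
by case: arg_maxP => // i iA H j; exact: H.
Qed.

(** Finitely many sets share one cube; the strict inequality leaves the room for truncation. *)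
Lemma vol_truncate {R : realType} {d : nat} {I : finType}
    (A : I -> set 'rV[R]_d.+1) (J : {set I}) (c : \bar R) :
  (forall j, j \in J -> (c < vol (A j))%E) ->
  exists N : nat, forall j, j \in J -> (c <= vol (A j `&` cube d.+1 N%:R%:E))%E.
Proof.
move=> cA; have /choice[N HN] : forall j, exists N : nat,
    j \in J -> (c < vol (A j `&` cube d.+1 N%:R%:E))%E.
  move=> j; have [jJ|] := boolP (j \in J); last by exists 0%N.
  by have [N HN] := vol_gt_cube _ _ (cA j jJ); exists N.
exists (\max_j N j) => j jJ; apply: le_trans (ltW (HN j jJ)) _.
by apply: le_vol; apply: setIS; apply: subset_cube; rewrite lee_fin ler_nat leq_bigmax.
Qed.

Lemma bigcapU1 {T : Type} {fT : finType} (F : fT -> set T) (U : {set fT}) (c : fT) :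
  \bigcap_(i in [set i | i \in (c |: U)%SET]) F i =
  (\bigcap_(i in [set i | i \in U]) F i) `&` F c.
Proof.
apply/seteqP; split => x.
  move=> xF; split; first by move=> i /= iU; apply: xF; rewrite /= !inE iU orbT.
  by apply: xF; rewrite /= !inE eqxx.
by move=> [xU xc] i /=; rewrite !inE => /orP[/eqP ->//|]; exact: xU.
Qed.

(** Sending T to the pair (T - c, c) is injective. Its values are pairs of a k-element set U and an
    element of [J U]; the U with the largest [J U] is at least average. *)
Lemma fractional_count {n k : nat} (TT : {set {set 'I_n}})
    (J : {set 'I_n} -> {set 'I_n}) :
  (0 < #|TT|)%N -> (forall T, T \in TT -> #|T| = k.+1) ->
  (forall T, T \in TT -> exists2 c, c \in T & c \in J (T :\ c)%SET) ->
  exists U, (#|TT| <= 'C(n, k) * #|J U|)%N.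
Proof.
move=> TT0 TTk TTc.
have /choice[c Hc] : forall T, exists c, T \in TT ->
    c \in T /\ c \in J (T :\ c)%SET.
  move=> T; have [TTT|] := boolP (T \in TT); last first.
    have [T0 T0T] := card_gt0P TT0; have [c _ _] := TTc T0 T0T.
    by exists c.
  by have [c cT cJ] := TTc T TTT; exists c.
pose P := finset (fun p : {set 'I_n} * 'I_n => (#|p.1| == k) && (p.2 \in J p.1)).
pose f T : {set 'I_n} * 'I_n := ((T :\ c T)%SET, c T).
have fP T : T \in TT -> f T \in P.
  move=> TTT; have [cT cJ] := Hc T TTT; rewrite inE /= cJ andbT.
  by have := TTk T TTT; rewrite (cardsD1 (c T)) cT add1n => -[->].
have finj : {in TT &, injective f}.
  move=> T T' TTT TTT' [E1 E2].
  rewrite -(finset.setD1K (Hc T TTT).1) -(finset.setD1K (Hc T' TTT').1).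
  by rewrite E1 E2.
have TP : (#|TT| <= #|P|)%N.
  rewrite -(card_in_imset finj); apply: subset_leq_card.
  by apply/fintype.subsetP => _ /imsetP[T TTT ->]; exact: fP.
pose UU := finset (fun U : {set 'I_n} => #|U| == k).
have UU0 : (0 < #|UU|)%N.
  have [T TTT] := card_gt0P TT0; have := fP T TTT; rewrite inE => /andP[Uk _].
  by apply/card_gt0P; exists (f T).1; rewrite inE.
have [U UUU Umax] := exists_max (fun U => #|J U|) UU UU0.
exists U; apply: leq_trans TP _.
have -> : 'C(n, k) = #|UU| by rewrite card_draws card_ord.
rewrite -sum_nat_const -sum1dep_card.
rewrite -(pair_big_dep (fun U : {set 'I_n} => #|U| == k) (fun U c => c \in J U)
   (fun _ _ => 1%N)) /=.
rewrite (eq_bigl (mem UU)); last by move=> V; rewrite [RHS]inE.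
by apply: leq_sum => V VU; rewrite sum1_card; exact: Umax.
Qed.

(** Turns the factor n - k + 1 from the ratio of consecutive binomial coefficients into a multiple
    of n. *)
Lemma leq_fraction (n k : nat) :
  (0 < k)%N -> (k <= n)%N -> (n <= k * (n - k.-1))%N.
Proof.
case: k => // k _ kn /=; have [m ->] : exists m, n = (m + k.+1)%N.
  by exists (n - k.+1)%N; rewrite subnK.
nia.
Qed.

(** The gap between [w] and [w'] pays for truncation to a bounded set. The conclusion w <= 2 will
    exclude an infinite w(d). *)
Lemma fractional_helly_vol {R : realType} {d M : nat} (w w' : R) :
  wprop d.+1 w -> 0 < w' -> w' < w -> (0 < M)%N ->
  forall (alpha : R) (n : nat) (F : 'I_n -> set 'rV[R]_d.+1),
    0 < alpha -> (2 * d.+1 <= n)%N -> (forall i, convex (F i)) ->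
    alpha * ('C(n, 2 * d.+1))%:R <=
      (#|finset (fun S : {set 'I_n} => (#|S| == 2 * d.+1)%N &&
         `[< (1%:E <= vol (\bigcap_(i in [set i | i \in S]) F i))%E >])|)%:R ->
    w <= 2 /\ exists S : {set 'I_n},
      ((2 * d.+1) ^ 2 * #|{: {set {ffun 'I_d.+1 -> 'I_M}}}|)%:R^-1 * alpha * n%:R
        <= (#|S|)%:R /\
      ((w' - 4 ^+ d.+1 / M%:R * ((4 * d.+1%:R) ^+ d.+1 * 2))%:E
        <= vol (\bigcap_(i in [set i | i \in S]) F i))%E.
Proof.
move=> wpw w'0 ww' M0 alpha n F a0 dn cF.
set TT := finset _ => HTT.
pose cap (U : {set 'I_n}) := \bigcap_(i in [set i | i \in U]) F i.
have /choice[t Ht] : forall U, exists t, (1%:E <= vol (cap U))%E ->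
    (1%:E <= vol (cap U `&` cube d.+1 t))%E /\
    (vol (cap U `&` cube d.+1 t) <= 2%:E)%E.
  move=> U; have [U1|] := pselect (1%:E <= vol (cap U))%E; last by exists 0%E.
  by have [t tU] := exists_height _ U1; exists t.
pose K U := cap U `&` cube d.+1 (t U).
(* The second condition ensures that [t U] is a genuine height and not the default value 0. *)
pose J U := finset (fun c : 'I_n => `[< (w%:E <= vol (K U `&` F c))%E /\
   (1%:E <= vol (cap U))%E >]).
have [n0 C0] : (0 < n)%N /\ (0 < 'C(n, 2 * d.+1))%N by rewrite bin_gt0; lia.
have TT0 : (0 < #|TT|)%N.
  by rewrite -(ltr0n R); apply: lt_le_trans HTT; rewrite mulr_gt0// ltr0n.
have TTk T : T \in TT -> #|T| = (2 * d.+1).-1.+1.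
  by rewrite inE => /andP[/eqP -> _]; lia.
have capD1 (T : {set 'I_n}) i : cap T `<=` cap (T :\ i)%SET.
  by move=> x xT j /=; rewrite !inE => /andP[_ jT]; exact: xT.
have TTc T : T \in TT -> exists2 c, c \in T & c \in J (T :\ c)%SET.
  rewrite inE => /andP[/eqP Td /asboolP T1].
  have T0 : (0 < #|T|)%N by rewrite Td; lia.
  (* The cube of T - c contains the cubes of all other T - i, so each T - i meets it in volume at
     least 1. *)
  have [c cT cmax] := exists_max (fun c => t (T :\ c)%SET) T T0.
  exists c => //; rewrite inE; apply/asboolP; split; last first.
    by apply: le_trans T1 _; apply: le_vol; exact: capD1.
  have := @wprop_extra R d.+1 n w F T (cube d.+1 (t (T :\ c)%SET)) wpw cF
     (convex_cube _) Td T1.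
  have -> : \bigcap_(i in [set i | i \in T]) F i = cap (T :\ c)%SET `&` F c.
    by rewrite -{1}(finset.setD1K cT) bigcapU1.
  rewrite /K -!setIA (setIC (F c)); apply => i iT.
  have Ti1 : (1%:E <= vol (cap (T :\ i)%SET))%E.
    by apply: le_trans T1 _; apply: le_vol; exact: capD1.
  apply: le_trans (Ht _ Ti1).1 _; apply: le_vol; apply: setIS.
  by apply: subset_cube; exact: cmax.
have [U HU] := fractional_count TT J TT0 TTk TTc.
have J0 : (0 < #|J U|)%N.
  by move: (leq_trans TT0 HU); rewrite muln_gt0 => /andP[].
have U1 : (1%:E <= vol (cap U))%E.
  by have [c] := card_gt0P J0; rewrite inE => /asboolP[].
have [Kt1 Kt2] := Ht U U1.
split.
  have [c] := card_gt0P J0; rewrite inE => /asboolP[wK _].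
  rewrite -lee_fin; apply: le_trans wK (le_trans _ Kt2).
  by apply: le_vol; exact: subIsetl.
(* [K U] may be unbounded when its height is infinite. *)
have [|N HN] := @vol_truncate R d _ (fun c => K U `&` F c) (J U) w'%:E
 _.
  move=> c; rewrite inE => /asboolP[wK _].
  by apply: lt_le_trans wK; rewrite lte_fin.
have [||||S [JS Sv]] := @vol_common_part R d M _ N%:R
  (K U `&` cube d.+1 N%:R%:E) F (J U) w' M0 _ _ _ cF w'0 _ J0.
- apply: convexI; last exact: convex_cube.
  by apply: convexI; [exact: convex_bigcap|exact: convex_cube].
- exact: subIsetr.
- by apply: le_trans Kt2; apply: le_vol; exact: subIsetl.
- by move=> c cJ; rewrite setIAC; exact: HN.
exists S; split => //.
set L := #|{: {set {ffun 'I_d.+1 -> 'I_M}}}| in JS *.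
have L0 : (0 < L)%N by move: J0 => /leq_trans/(_ JS); rewrite muln_gt0 => /andP[].
(* Combines alpha C(n,k) <= C(n,k-1) |J U| with k C(n,k) = (n-k+1) C(n,k-1) for k = 2(d+1). *)
have key : alpha * n%:R <= (2 * d.+1)%:R ^+ 2 * #|J U|%:R.
  set k := (2 * d.+1)%N in dn HTT TTk C0 HU *.
  have k0 : (0 < k)%N by rewrite /k; lia.
  have kC : (k * 'C(n, k) = (n - k.-1) * 'C(n, k.-1))%N.
    by have := mul_bin_left n k.-1; rewrite prednK.
  have C1 : (0 < 'C(n, k.-1))%N by rewrite bin_gt0; lia.
  have nk := leq_fraction n k k0 dn.
  have H1 : alpha * (n - k.-1)%:R <= k%:R * #|J U|%:R.
    rewrite -(ler_pM2r (_ : 0 < 'C(n, k.-1)%:R)) ?ltr0n//.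
    rewrite -(mulrA alpha) -(natrM _ (n - k.-1)) -kC.
    rewrite natrM mulrCA -mulrA; apply: ler_wpM2l => //.
    by apply: le_trans HTT _; rewrite -natrM ler_nat mulnC.
  apply: le_trans (_ : alpha * (k * (n - k.-1))%:R <= _).
    by apply: ler_wpM2l; [exact: ltW|rewrite ler_nat].
  by rewrite natrM mulrCA expr2 -mulrA; apply: ler_wpM2l.
rewrite -mulrA ler_pdivrMl ?ltr0n ?muln_gt0 ?expn_gt0 ?L0//.
apply: le_trans key _; rewrite [in leRHS]natrM [in leRHS]natrX -[leRHS]mulrA.
apply: ler_wpM2l.
  by rewrite exprn_ge0.
by rewrite -natrM ler_nat.
Qed.

Theorem theorem1 (R : realType) (d : nat) (eps : R) :
  (0 < d)%N -> 0 < eps ->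
  exists c0 : R, 0 < c0 /\
    forall (alpha : R) (n : nat) (F : 'I_n -> set 'rV[R]_d),
      0 < alpha -> alpha <= 1 -> (2 * d <= n)%N ->
      (forall i, convex (F i)) ->
      alpha * ('C(n, 2 * d))%:R <=
        (#|finset (fun S : {set 'I_n} =>
             (#|S| == 2 * d)%N && `[< (1%:E <= vol (\bigcap_(i in [set i | i \in S]) F i))%E >])|)%:R ->
      exists S : {set 'I_n},
        c0 * alpha * n%:R <= (#|S|)%:R /\
        (((1 - eps)%:E * wd d)%E <= vol (\bigcap_(i in [set i | i \in S]) F i))%E.
Proof.
case: d => // d _ eps0.
have wd0 : (0 <= wd d.+1 :> \bar R)%E.
  by apply: ereal_sup_ubound; exists 0 => // G _ _; exact: vol_ge0.
(* The property passes to smaller numbers, so everything below the supremum has it. *)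
have wd_lt (w : R) : (w%:E < wd d.+1)%E -> wprop d.+1 w.
  move=> /ereal_sup_gt[_ [v wv <-]]; rewrite lte_fin => wlt G cG G1.
  by apply: le_trans (wv G cG G1); rewrite lee_fin ltW.
(* If the required volume is at most 0, the whole family will do. *)
have [triv|nontriv] := leP ((1 - eps)%:E * wd d.+1)%E 0%E.
  exists 1; split => // alpha n F a0 a1 _ _ _; exists [set: 'I_n]%SET; split.
    by rewrite mul1r cardsT card_ord ler_piMl.
  by apply: le_trans triv (vol_ge0 _).
have eps1 : eps < 1.
  rewrite ltNge; apply/negP => e1; move: nontriv; rewrite ltNge mule_le0_ge0//.
  by rewrite lee_fin subr_le0.
case E : (wd d.+1 : \bar R) => [w| |]; last by move: wd0; rewrite E.
- have w0 : 0 < w by move: nontriv; rewrite E -EFinM lte_fin pmulr_rgt0// subr_gt0.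
  (* The loss [eps * w] is split into thirds: for staying below the supremum, for truncation, and
     for the grid, whose fineness [M] is chosen accordingly. *)
  pose V : R := 4 ^+ d.+1 * ((4 * d.+1%:R) ^+ d.+1 * 2).
  pose M := (Num.truncn (V / (eps / 3 * w))).+1.
  have ew : 0 < eps / 3 * w by rewrite !mulr_gt0.
  have VM : 4 ^+ d.+1 / M%:R * ((4 * d.+1%:R) ^+ d.+1 * 2) <= eps / 3 * w.
    rewrite mulrAC ler_pdivrMr ?ltr0n// [leRHS]mulrC -ler_pdivrMr//.
    exact/ltW/truncnS_gt.
  have wpw : wprop d.+1 ((1 - eps / 3) * w).
    by apply: wd_lt; rewrite E lte_fin; lra.
  have w1 : 0 < (1 - 2 / 3 * eps) * w by rewrite mulr_gt0//; lra.
  have w2 : (1 - 2 / 3 * eps) * w < (1 - eps / 3) * w by rewrite ltr_pM2r//; lra.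
  exists ((2 * d.+1) ^ 2 * #|{: {set {ffun 'I_d.+1 -> 'I_M}}}|)%:R^-1; split.
    rewrite invr_gt0 ltr0n muln_gt0 expn_gt0 /=.
    by apply/card_gt0P; exists finset.set0.
  move=> alpha n F a0 a1 dn cF HTT.
  have [_ [S [Scard Svol]]] :=
    @fractional_helly_vol R d M _ _ wpw w1 w2 (ltn0Sn _) alpha n F a0 dn cF HTT.
  exists S; split => //; apply: le_trans Svol.
  by rewrite -EFinM lee_fin; lra.
(* If w(d) were infinite, 3 would have the defining property, against the bound 2. *)
- exists 1; split => // alpha n F a0 a1 dn cF HTT.
  have wp3 : wprop d.+1 (3 : R) by apply: wd_lt; rewrite E ltry.
  have [] := @fractional_helly_vol R d 1 3 1 wp3 ltr01 _ isT alpha n F a0 dn cF HTT.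
    by lra.
  by move=> H; exfalso; lra.
Qed.
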